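(* Assume the scatter-step setting below. Then $$\mathbb{E}\big[\Delta(\theta_1-\eta G_1,\dots,\theta_{h_{ps}}-\eta G_{h_{ps}})\big]\le 6d\eta h_w\sigma'+(1+3d\eta l)\,\Delta(\theta_1,\dots,\theta_{h_{ps}}),$$ where the expectation is over the randomness of the gradient estimates (and anything the received lists depend on).
   Context: Coordinate-wise diameters: $\Delta_i(v_1,\dots,v_h)=\max_{j,k}|v_j[i]-v_k[i]|$, $\Delta=\sum_{i=1}^d\Delta_i$. Minimum–Diameter Averaging: for $f\ge0$, $q\ge2f+1$, $x_1,\dots,x_q\in\mathbb{R}^d$, $\mathrm{MDA}_f(x_1,\dots,x_q)$ is the average of the $x_i$, $i\in I^*$, where $I^*$ is an index set of size $q-f$ minimizing $\max_{i,j\in I}\|x_i-x_j\|_2$ over all $I\subset\{1,\dots,q\}$ with $|I|=q-f$ (ties arbitrary). Scatter-step setting: $L:\mathbb{R}^d\to\mathbb{R}$ differentiable with $l$-Lipschitz gradient; learning rate $\eta>0$; correct server parameters $\theta_1,\dots,\theta_{h_{ps}}\in\mathbb{R}^d$; correct workers' models $x_1,\dots,x_{h_w}\in\mathbb{R}^d$ with $\min_k\theta_k[i]\le x_r[i]\le\max_k\theta_k[i]$ for all coordinates $i$ and all $r$; random gradient estimates $g_1,\dots,g_{h_w}$ with $\mathbb{E}\|g_r-\nabla L(x_r)\|_2\le\sigma'$; integers $f_w\ge1$, $q_w\ge2f_w+1$; each correct server $j$ computes $G_j=\mathrm{MDA}_{f_w}$ of a list of $q_w$ vectors of which at least $q_w-f_w$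 entries belong to $\{g_1,\dots,g_{h_w}\}$ and the others are arbitrary. *)

(* Defs.v *)
From Stdlib Require Import Reals Lra List.
Open Scope R_scope.

(* Vectors of R^d are represented as functions nat -> R; only the
   coordinates 0..d-1 are ever inspected (d is passed explicitly). *)
Definition vec := nat -> R.
Definition vsub (u v : vec) : vec := fun i => u i - v i.
Definition vscal (a : R) (u : vec) : vec := fun i => a * u i.

Fixpoint sumR (n : nat) (f : nat -> R) : R :=
  match n with O => 0 | S m => sumR m f + f m end.

Definition inner (d : nat) (u v : vec) : R := sumR d (fun i => u i * v i).
Definition norm2 (d : nat) (v : vec) : R := sqrt (sumR d (fun i => v i * v i)).

(* maximum of a list of (nonnegative) reals; 0 for the empty list *)
Definition maxL (l : list R) : R := fold_right Rmax 0 l.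

Definition coord_diam (h : nat) (vs : nat -> vec) (i : nat) : R :=
  maxL (map (fun j => maxL (map (fun k => Rabs (vs j i - vs k i)) (seq 0 h)))
            (seq 0 h)).

Definition coord_Delta (d h : nat) (vs : nat -> vec) : R := sumR d (coord_diam h vs).

Definition set_diam (d : nat) (xs : nat -> vec) (I : list nat) : R :=
  maxL (flat_map (fun i => map (fun j => norm2 d (vsub (xs i) (xs j))) I) I).

Definition avg_over (xs : nat -> vec) (I : list nat) : vec :=
  fun c => / INR (length I) * fold_right Rplus 0 (map (fun i => xs i c) I).

Definition admissible (q f : nat) (I : list nat) : Prop :=
  NoDup I /\ (forall i, In i I -> (i < q)%nat) /\ length I = (q - f)%nat.

(* out is a (tie-breaking arbitrary) value of MDA_f(xs 0, ..., xs (q-1)) *)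
Definition is_MDA (d f q : nat) (xs : nat -> vec) (out : vec) : Prop :=
  exists I, admissible q f I /\
    (forall J, admissible q f J -> set_diam d xs I <= set_diam d xs J) /\
    (forall c, (c < d)%nat -> out c = avg_over xs I c).

Definition is_gradient (d : nat) (L : vec -> R) (G : vec -> vec) : Prop :=
  forall x eps, 0 < eps -> exists delta, 0 < delta /\
    forall y, norm2 d (vsub y x) < delta ->
      Rabs (L y - L x - inner d (G x) (vsub y x)) <= eps * norm2 d (vsub y x).

Definition lipschitz_grad (d : nat) (G : vec -> vec) (l : R) : Prop :=
  forall x y, norm2 d (vsub (G x) (G y)) <= l * norm2 d (vsub x y).

(* An abstract expectation on random variables Omega -> R: a normalized,
   linear, monotone functional on a class of integrable functions containing
   constants and closed under sums and scalar multiples. *)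
Record Expectation (Omega : Type) := {
  Integ : (Omega -> R) -> Prop;
  Expect : (Omega -> R) -> R;
  int_const : forall c, Integ (fun _ => c);
  int_add : forall f g, Integ f -> Integ g -> Integ (fun w => f w + g w);
  int_scal : forall a f, Integ f -> Integ (fun w => a * f w);
  Exp_const : forall c, Expect (fun _ => c) = c;
  Exp_add : forall f g, Integ f -> Integ g ->
      Expect (fun w => f w + g w) = Expect f + Expect g;
  Exp_scal : forall a f, Integ f -> Expect (fun w => a * f w) = a * Expect f;
  Exp_mono : forall f g, Integ f -> Integ g ->
      (forall w, f w <= g w) -> Expect f <= Expect g
}.
Arguments Integ {Omega} _ _.
Arguments Expect {Omega} _ _.

(* Main.v *)
(* Write Delta for the sum of the coordinate diameters of the server parameters
   theta_j, and S = sum_r |g_r - grad L(x_r)| for the total gradient noise.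
   1. Each worker model lies coordinatewise in the hull of the theta_j, so two
      models differ by at most Delta in l1-norm, hence in l2-norm; by the
      Lipschitz property two honest estimates are within B = 2 S + l Delta.
   2. Robustness of MDA: if q - f > q/2 entries of a list are pairwise within B,
      the minimal-diameter subset has diameter <= B and meets the honest entries,
      so its average is within B (in every coordinate) of an honest entry.
   3. Hence in every coordinate two updated parameters theta_j - eta G_j differ
      by at most Delta_i(theta) + 3 eta B; summing over the d coordinates gives
      Delta(theta - eta G) <= 6 d eta S + (1 + 3 d eta l) Delta(theta).
   4. Taking expectations, linearity and monotonicity give E[S] <= h_w sigma'. *)
Require Import Defs.
From Stdlib Require Import Reals List Lia Lra Psatz Classical.
Open Scope R_scope.

Lemma sumR_ext n f g : (forall i, (i < n)%nat -> f i = g i) -> sumR n f = sumR n g.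
Proof.
  induction n as [|n IH]; intros H; simpl; [reflexivity|].
  rewrite IH by (intros; apply H; lia). now rewrite H by lia.
Qed.

Lemma sumR_le n f g : (forall i, (i < n)%nat -> f i <= g i) -> sumR n f <= sumR n g.
Proof.
  induction n as [|n IH]; intros H; simpl; [lra|].
  apply Rplus_le_compat; [apply IH; intros; apply H|apply H]; lia.
Qed.

Lemma sumR_plus n f g : sumR n (fun i => f i + g i) = sumR n f + sumR n g.
Proof. induction n; simpl; lra. Qed.

Lemma sumR_const n c : sumR n (fun _ => c) = INR n * c.
Proof. induction n as [|n IH]; simpl sumR; [simpl; lra|]. rewrite S_INR; lra. Qed.

Lemma sumR_nonneg n f : (forall i, (i < n)%nat -> 0 <= f i) -> 0 <= sumR n f.
Proof.
  intros H. replace 0 with (sumR n (fun _ => 0)) by (rewrite sumR_const; ring).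
  now apply sumR_le.
Qed.

Lemma sumR_ge_term n f i :
  (forall j, (j < n)%nat -> 0 <= f j) -> (i < n)%nat -> f i <= sumR n f.
Proof.
  induction n as [|n IH]; intros H Hi; [lia|]. simpl.
  assert (Hrest : 0 <= sumR n f) by (apply sumR_nonneg; intros; apply H; lia).
  destruct (Nat.eq_dec i n) as [->|Hne]; [lra|].
  assert (f i <= sumR n f) by (apply IH; intros; try apply H; lia).
  assert (0 <= f n) by (apply H; lia). lra.
Qed.

Lemma maxL_ge0 l : 0 <= maxL l.
Proof.
  induction l as [|a l IH]; simpl; [lra|]. eapply Rle_trans; [exact IH|apply Rmax_r].
Qed.

Lemma maxL_In a l : In a l -> a <= maxL l.
Proof.
  induction l as [|b l IH]; simpl; [tauto|]. intros [->|H]; [apply Rmax_l|].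
  eapply Rle_trans; [exact (IH H)|apply Rmax_r].
Qed.

Lemma maxL_le l M : 0 <= M -> (forall a, In a l -> a <= M) -> maxL l <= M.
Proof. induction l; simpl; intros; [lra|]. apply Rmax_lub; auto. Qed.

Lemma sq_sum_nonneg d v : 0 <= sumR d (fun i => v i * v i).
Proof. apply sumR_nonneg; intros; nra. Qed.

Lemma norm2_ext d u v : (forall i, (i < d)%nat -> u i = v i) -> norm2 d u = norm2 d v.
Proof. intros H. unfold norm2. f_equal. apply sumR_ext. intros i Hi. now rewrite H. Qed.

Lemma norm2_sym d u v : norm2 d (vsub u v) = norm2 d (vsub v u).
Proof. unfold norm2, vsub. f_equal. apply sumR_ext. intros. ring. Qed.

Lemma coord_le_norm2 d v i : (i < d)%nat -> Rabs (v i) <= norm2 d v.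
Proof.
  intros Hi. unfold norm2. rewrite <- sqrt_Rsqr_abs. apply sqrt_le_1_alt.
  apply (sumR_ge_term d (fun i => v i * v i)); auto. intros; nra.
Qed.

Lemma norm2_le_l1 d v : norm2 d v <= sumR d (fun i => Rabs (v i)).
Proof.
  unfold norm2. induction d as [|d IH]; simpl; [rewrite sqrt_0; lra|].
  set (A := sumR d (fun i => v i * v i)) in *.
  assert (HA : 0 <= A) by apply sq_sum_nonneg.
  assert (HsA : 0 <= sqrt A) by apply sqrt_pos.
  assert (Hv : 0 <= Rabs (v d)) by apply Rabs_pos.
  apply Rle_trans with (sqrt A + Rabs (v d)); [|lra].
  rewrite <- (sqrt_square (sqrt A + Rabs (v d))) by lra. apply sqrt_le_1_alt.
  assert (sqrt A * sqrt A = A) by (apply sqrt_sqrt; lra).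
  assert (Rabs (v d) * Rabs (v d) = v d * v d)
    by (rewrite <- Rabs_mult; apply Rabs_right; nra).
  nra.
Qed.

(* Squared Cauchy-Schwarz inequality, by induction on the dimension: the new
   cross term 2 S x y is bounded by A y^2 + B x^2 via S^2 <= A B and AM-GM. *)
Lemma cauchy_schwarz_sq n a b :
  sumR n (fun i => a i * b i) * sumR n (fun i => a i * b i)
  <= sumR n (fun i => a i * a i) * sumR n (fun i => b i * b i).
Proof.
  induction n as [|n IH]; simpl sumR; [lra|].
  set (S := sumR n (fun i => a i * b i)) in *.
  set (A := sumR n (fun i => a i * a i)) in *.
  set (B := sumR n (fun i => b i * b i)) in *.
  set (x := a n). set (y := b n).
  assert (HA : 0 <= A) by apply sq_sum_nonneg.
  assert (HB : 0 <= B) by apply sq_sum_nonneg.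
  assert (Hcross : 2 * S * (x * y) <= A * (y * y) + B * (x * x)).
  { assert (Hsq : Rsqr (2 * S * (x * y)) <= Rsqr (A * (y * y) + B * (x * x))).
    { assert (S * S * ((x * y) * (x * y)) <= A * B * ((x * y) * (x * y)))
        by (apply Rmult_le_compat_r; nra).
      assert (Rsqr (A * (y * y) + B * (x * x))
              = Rsqr (A * (y * y) - B * (x * x)) + 4 * (A * B * ((x * y) * (x * y))))
        by (unfold Rsqr; ring).
      assert (Rsqr (2 * S * (x * y)) = 4 * (S * S * ((x * y) * (x * y))))
        by (unfold Rsqr; ring).
      pose proof (Rle_0_sqr (A * (y * y) - B * (x * x))). lra. }
    apply Rsqr_le_abs_0 in Hsq. rewrite (Rabs_right (_ + _)) in Hsq by nra.
    pose proof (Rle_abs (2 * S * (x * y))). lra. }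
  nra.
Qed.

Lemma cauchy_schwarz n a b : sumR n (fun i => a i * b i) <= norm2 n a * norm2 n b.
Proof.
  unfold norm2. rewrite <- sqrt_mult by apply sq_sum_nonneg.
  eapply Rle_trans; [apply RRle_abs|]. rewrite <- sqrt_Rsqr_abs.
  apply sqrt_le_1_alt. apply cauchy_schwarz_sq.
Qed.

Lemma minkowski n a b : norm2 n (fun i => a i + b i) <= norm2 n a + norm2 n b.
Proof.
  pose proof (cauchy_schwarz n a b).
  pose proof (sqrt_pos (sumR n (fun i => a i * a i))).
  pose proof (sqrt_pos (sumR n (fun i => b i * b i))).
  assert (norm2 n a * norm2 n a = sumR n (fun i => a i * a i))
    by (apply sqrt_sqrt, sq_sum_nonneg).
  assert (norm2 n b * norm2 n b = sumR n (fun i => b i * b i))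
    by (apply sqrt_sqrt, sq_sum_nonneg).
  unfold norm2 in *. rewrite <- (sqrt_square (_ + _)) by lra. apply sqrt_le_1_alt.
  replace (sumR n (fun i => (a i + b i) * (a i + b i))) with
    (sumR n (fun i => a i * a i) + 2 * sumR n (fun i => a i * b i)
     + sumR n (fun i => b i * b i)) by (clear; induction n; simpl; lra).
  nra.
Qed.

Lemma norm2_triangle d u v w :
  norm2 d (vsub u w) <= norm2 d (vsub u v) + norm2 d (vsub v w).
Proof.
  rewrite (norm2_ext d (vsub u w) (fun i => vsub u v i + vsub v w i))
    by (intros; unfold vsub; ring).
  apply minkowski.
Qed.

Lemma coord_diam_ge0 h vs i : 0 <= coord_diam h vs i.
Proof. apply maxL_ge0. Qed.

Lemma coord_diam_ge_pair h vs i j k :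
  (j < h)%nat -> (k < h)%nat -> Rabs (vs j i - vs k i) <= coord_diam h vs i.
Proof.
  intros Hj Hk. unfold coord_diam.
  eapply Rle_trans; [|apply maxL_In, in_map, in_seq; split; [lia|exact Hj]].
  apply maxL_In, (in_map (fun k0 => Rabs (vs j i - vs k0 i))), in_seq. lia.
Qed.

Lemma coord_diam_le h vs i M :
  0 <= M -> (forall j k, (j < h)%nat -> (k < h)%nat -> Rabs (vs j i - vs k i) <= M) ->
  coord_diam h vs i <= M.
Proof.
  intros HM H. apply maxL_le; auto. intros a Ha.
  apply in_map_iff in Ha as [j [<- Hj]]. apply maxL_le; auto. intros b Hb.
  apply in_map_iff in Hb as [k [<- Hk]]. apply in_seq in Hj, Hk. apply H; lia.
Qed.

Lemma set_diam_ge_pair d xs I k k' :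
  In k I -> In k' I -> norm2 d (vsub (xs k) (xs k')) <= set_diam d xs I.
Proof.
  intros Hk Hk'. apply maxL_In, in_flat_map. exists k. split; auto.
  now apply (in_map (fun j => norm2 d (vsub (xs k) (xs j)))).
Qed.

Lemma set_diam_le d xs I B :
  0 <= B -> (forall k k', In k I -> In k' I -> norm2 d (vsub (xs k) (xs k')) <= B) ->
  set_diam d xs I <= B.
Proof.
  intros HB H. apply maxL_le; auto. intros a Ha.
  apply in_flat_map in Ha as [k [Hk Ha]]. apply in_map_iff in Ha as [k' [<- Hk']]. auto.
Qed.

Lemma common_index q (A B : list nat) :
  NoDup A -> NoDup B -> (forall a, In a A -> (a < q)%nat) ->
  (forall b, In b B -> (b < q)%nat) -> (q < length A + length B)%nat ->
  exists k, In k A /\ In k B.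
Proof.
  intros HA HB HAq HBq Hlen. apply NNPP. intros Hdisj.
  assert (Hnd : NoDup (A ++ B)).
  { apply NoDup_app; auto. intros a Ha Hb. apply Hdisj; eauto. }
  assert (Hincl : incl (A ++ B) (seq 0 q)).
  { intros a Ha. apply in_seq. apply in_app_or in Ha as [Ha|Ha];
      [apply HAq in Ha|apply HBq in Ha]; lia. }
  pose proof (NoDup_incl_length Hnd Hincl) as Hle.
  rewrite length_app, length_seq in Hle. lia.
Qed.

Lemma avg_over_close (xs : nat -> vec) (I : list nat) c v B :
  I <> nil -> (forall k, In k I -> Rabs (xs k c - v) <= B) ->
  Rabs (avg_over xs I c - v) <= B.
Proof.
  intros Hne H. unfold avg_over.
  set (s := fold_right Rplus 0 (map (fun i => xs i c) I)).
  set (n := INR (length I)).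
  assert (Hs : n * (v - B) <= s <= n * (v + B)).
  { unfold s, n. clear Hne. induction I as [|a I IH]; cbn [length map fold_right];
      [simpl; lra|].
    rewrite S_INR. assert (Ha : - B <= xs a c - v <= B).
    { pose proof (H a (or_introl eq_refl)) as Ha. unfold Rabs in Ha.
      destruct (Rcase_abs (xs a c - v)); lra. }
    destruct IH as [IH1 IH2]; [intros; apply H; now right|]. lra. }
  assert (Hn : 0 < n) by (apply lt_0_INR; destruct I; [easy|simpl; lia]).
  replace (/ n * s - v) with (/ n * (s - n * v)) by (field; lra).
  assert (Hinv : 0 < / n) by now apply Rinv_0_lt_compat.
  assert (/ n * n = 1) by (field; lra).
  apply Rabs_le. split.
  - assert (/ n * - (n * B) <= / n * (s - n * v)) by (apply Rmult_le_compat_l; lra). nra.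
  - assert (/ n * (s - n * v) <= / n * (n * B)) by (apply Rmult_le_compat_l; lra). nra.
Qed.

(* The honest entries form an admissible set, so the minimal-diameter set I has
   diameter <= B; I meets K, and its average stays within B of that member. *)
Lemma mda_near_honest d f q (xs : nat -> vec) out (K : list nat) n (gs : nat -> vec) B :
  (2 * f < q)%nat -> NoDup K -> (q - f <= length K)%nat ->
  (forall k, In k K -> (k < q)%nat /\
     exists r, (r < n)%nat /\ forall i, (i < d)%nat -> xs k i = gs r i) ->
  (forall r r', (r < n)%nat -> (r' < n)%nat -> norm2 d (vsub (gs r) (gs r')) <= B) ->
  0 <= B -> is_MDA d f q xs out ->
  exists r, (r < n)%nat /\ forall i, (i < d)%nat -> Rabs (out i - gs r i) <= B.
Proof.
  intros Hq HK HlK Hhon Hclose HB0 [I [[HI [HIq HIl]] [Hmin Hout]]].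
  assert (HKq : forall k, In k K -> (k < q)%nat) by (intros k Hk; apply Hhon, Hk).
  assert (HKclose : forall k k', In k K -> In k' K -> norm2 d (vsub (xs k) (xs k')) <= B).
  { intros k k' Hk Hk'.
    destruct (Hhon k Hk) as [_ [r [Hr Er]]]. destruct (Hhon k' Hk') as [_ [r' [Hr' Er']]].
    rewrite (norm2_ext d _ (vsub (gs r) (gs r'))) by (intros; unfold vsub; now rewrite Er, Er').
    auto. }
  set (J := firstn (q - f) K).
  assert (HJK : forall k, In k J -> In k K)
    by (intros k Hk; rewrite <- (firstn_skipn (q - f) K); apply in_or_app; auto).
  assert (HJ : admissible q f J).
  { split; [|split].
    - apply (NoDup_app_remove_r _ (skipn (q - f) K)). unfold J. now rewrite firstn_skipn.
    - intros; apply HKq; auto.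
    - now apply firstn_length_le. }
  assert (HdiamI : set_diam d xs I <= B)
    by (eapply Rle_trans; [apply (Hmin J HJ)|apply set_diam_le; auto]).
  destruct (common_index q I K HI HK HIq HKq) as [k0 [Hk0I Hk0K]]; [lia|].
  destruct (Hhon k0 Hk0K) as [_ [r [Hr Er]]].
  exists r. split; auto. intros i Hi. rewrite Hout, <- Er by exact Hi.
  apply avg_over_close; [intros ->; destruct Hk0I|].
  intros k Hk. eapply Rle_trans; [|exact HdiamI].
  eapply Rle_trans; [|apply (set_diam_ge_pair d xs I k k0); auto].
  apply (coord_le_norm2 d (vsub (xs k) (xs k0)) i Hi).
Qed.

Lemma expect_sum_le (Omega : Type) (P : Expectation Omega) n (f : nat -> Omega -> R) s :
  (forall r, (r < n)%nat -> Integ P (f r) /\ Expect P (f r) <= s) ->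
  Integ P (fun w => sumR n (fun r => f r w)) /\
  Expect P (fun w => sumR n (fun r => f r w)) <= INR n * s.
Proof.
  induction n as [|n IH]; intros H; simpl sumR.
  - split; [apply int_const|]. rewrite Exp_const. simpl. lra.
  - destruct IH as [I1 E1]; [intros; apply H; lia|].
    destruct (H n) as [I2 E2]; [lia|].
    split; [now apply int_add|].
    rewrite (Exp_add _ P _ (f n)) by assumption. rewrite S_INR. lra.
Qed.

Lemma expect_affine_bound (Omega : Type) (P : Expectation Omega) (S F : Omega -> R) a b M :
  0 <= a -> Integ P S -> Expect P S <= M -> Integ P F ->
  (forall w, F w <= a * S w + b) -> Expect P F <= a * M + b.
Proof.
  intros Ha HS HM HF HFS.
  assert (Hlin : Integ P (fun w => a * S w)) by now apply int_scal.
  eapply Rle_trans; [apply (Exp_mono _ P F (fun w => a * S w + b)); auto|].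
  - now apply int_add; [|apply int_const].
  - rewrite Exp_add, Exp_scal, Exp_const by (auto using int_const).
    apply Rplus_le_compat_r, Rmult_le_compat_l; assumption.
Qed.

Definition in_coord_hull (d hps : nat) (theta : nat -> vec) (y : vec) : Prop :=
  forall i, (i < d)%nat ->
    exists k1 k2, (k1 < hps)%nat /\ (k2 < hps)%nat /\ theta k1 i <= y i <= theta k2 i.

Lemma lipschitz_const_nonneg d (G : vec -> vec) l :
  (0 < d)%nat -> lipschitz_grad d G l -> 0 <= l.
Proof.
  intros Hd Hlip.
  set (u := vsub (fun _ => 0) (fun _ => 1)).
  assert (Hu : 0 < norm2 d u).
  { unfold norm2, u, vsub. apply sqrt_lt_R0.
    rewrite (sumR_ext _ _ (fun _ => 1)) by (intros; ring).
    rewrite sumR_const, Rmult_1_r. now apply lt_0_INR. }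
  pose proof (Hlip (fun _ => 0) (fun _ => 1)) as H.
  pose proof (sqrt_pos (sumR d (fun i => vsub (G (fun _ => 0)) (G (fun _ => 1)) i
                                     * vsub (G (fun _ => 0)) (G (fun _ => 1)) i))).
  fold u in H. unfold norm2 at 1 in H. nra.
Qed.

Lemma hull_points_close d hps theta y z :
  in_coord_hull d hps theta y -> in_coord_hull d hps theta z ->
  norm2 d (vsub y z) <= coord_Delta d hps theta.
Proof.
  intros Hy Hz. eapply Rle_trans; [apply norm2_le_l1|]. apply sumR_le. intros i Hi.
  destruct (Hy i Hi) as [k1 [k2 [Hk1 [Hk2 Hyb]]]].
  destruct (Hz i Hi) as [k1' [k2' [Hk1' [Hk2' Hzb]]]].
  pose proof (coord_diam_ge_pair hps theta i k2 k1' Hk2 Hk1').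
  pose proof (coord_diam_ge_pair hps theta i k2' k1 Hk2' Hk1).
  pose proof (Rle_abs (theta k2 i - theta k1' i)).
  pose proof (Rle_abs (theta k2' i - theta k1 i)).
  unfold vsub. apply Rabs_le. lra.
Qed.

Lemma honest_estimates_close d hps (theta : nat -> vec) (gradL : vec -> vec) l y z gy gz :
  lipschitz_grad d gradL l -> 0 <= l ->
  in_coord_hull d hps theta y -> in_coord_hull d hps theta z ->
  norm2 d (vsub gy gz)
  <= norm2 d (vsub gy (gradL y)) + norm2 d (vsub gz (gradL z)) + l * coord_Delta d hps theta.
Proof.
  intros Hlip Hl Hy Hz.
  pose proof (norm2_triangle d gy (gradL y) gz) as Ht1.
  pose proof (norm2_triangle d (gradL y) (gradL z) gz) as Ht2.
  rewrite (norm2_sym d (gradL z) gz) in Ht2.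
  pose proof (Hlip y z) as Hlipyz.
  pose proof (Rmult_le_compat_l l _ _ Hl (hull_points_close d hps theta y z Hy Hz)).
  lra.
Qed.

Lemma step_coord_gap a b Gj Gk g0 g1 eta : 0 <= eta ->
  Rabs ((a - eta * Gj) - (b - eta * Gk))
  <= Rabs (a - b) + eta * (Rabs (Gj - g0) + Rabs (g0 - g1) + Rabs (g1 - Gk)).
Proof.
  intros Heta.
  replace ((a - eta * Gj) - (b - eta * Gk))
    with ((a - b) + - (eta * ((Gj - g0) + (g0 - g1) + (g1 - Gk)))) by ring.
  eapply Rle_trans; [apply Rabs_triang|].
  rewrite Rabs_Ropp, Rabs_mult, (Rabs_pos_eq eta Heta).
  apply Rplus_le_compat_l, Rmult_le_compat_l; [exact Heta|].
  eapply Rle_trans; [apply Rabs_triang|].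
  pose proof (Rabs_triang (Gj - g0) (g0 - g1)). lra.
Qed.

Lemma scatter_step_Delta d hps hw eta (theta Gs gs : nat -> vec) B :
  0 <= eta -> 0 <= B ->
  (forall r r', (r < hw)%nat -> (r' < hw)%nat -> norm2 d (vsub (gs r) (gs r')) <= B) ->
  (forall j, (j < hps)%nat ->
     exists r, (r < hw)%nat /\ forall i, (i < d)%nat -> Rabs (Gs j i - gs r i) <= B) ->
  coord_Delta d hps (fun j => vsub (theta j) (vscal eta (Gs j)))
  <= coord_Delta d hps theta + 3 * INR d * eta * B.
Proof.
  intros Heta HB Hclose Hnear. unfold coord_Delta.
  apply Rle_trans with (sumR d (fun i => coord_diam hps theta i + eta * (3 * B))).
  - apply sumR_le. intros i Hi. apply coord_diam_le.
    { pose proof (coord_diam_ge0 hps theta i). nra. }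
    intros j k Hj Hk.
    destruct (Hnear j Hj) as [r0 [Hr0 Hj0]]. destruct (Hnear k Hk) as [r1 [Hr1 Hk1]].
    unfold vsub, vscal.
    eapply Rle_trans; [apply (step_coord_gap _ _ _ _ (gs r0 i) (gs r1 i) eta Heta)|].
    pose proof (coord_diam_ge_pair hps theta i j k Hj Hk).
    pose proof (Hj0 i Hi). pose proof (Hk1 i Hi).
    rewrite (Rabs_minus_sym (gs r1 i)).
    pose proof (coord_le_norm2 d (vsub (gs r0) (gs r1)) i Hi).
    pose proof (Hclose r0 r1 Hr0 Hr1). unfold vsub in *.
    apply Rplus_le_compat; [lra|]. apply Rmult_le_compat_l; lra.
  - rewrite sumR_plus, sumR_const. lra.
Qed.

(* Honest estimates are pairwise within B = 2 S + l Delta(theta),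
   so by MDA robustness each aggregate is within B of one of them. *)
Lemma scatter_step_sample_bound d (gradL : vec -> vec) l eta hps hw fw qw
    (theta x gs Gs : nat -> vec) (lsts : nat -> nat -> vec) :
  lipschitz_grad d gradL l -> 0 <= eta ->
  (forall r, (r < hw)%nat -> in_coord_hull d hps theta (x r)) ->
  (2 * fw < qw)%nat ->
  (forall j, (j < hps)%nat ->
     exists K, NoDup K /\ (qw - fw <= length K)%nat /\
       forall k, In k K -> (k < qw)%nat /\
         exists r, (r < hw)%nat /\ forall i, (i < d)%nat -> lsts j k i = gs r i) ->
  (forall j, (j < hps)%nat -> is_MDA d fw qw (lsts j) (Gs j)) ->
  coord_Delta d hps (fun j => vsub (theta j) (vscal eta (Gs j)))
  <= 6 * INR d * eta * sumR hw (fun r => norm2 d (vsub (gs r) (gradL (x r))))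
     + (1 + 3 * INR d * eta * l) * coord_Delta d hps theta.
Proof.
  intros Hlip Heta Hhull Hq Hlst Hmda.
  destruct (Nat.eq_dec d 0) as [->|Hd].
  {
    unfold coord_Delta. simpl. lra. }
  assert (Hl : 0 <= l) by (apply (lipschitz_const_nonneg d gradL); [lia|exact Hlip]).
  set (Dt := coord_Delta d hps theta).
  set (err := fun r => norm2 d (vsub (gs r) (gradL (x r)))).
  set (S := sumR hw err).
  assert (HB : 0 <= 2 * S + l * Dt).
  { apply Rplus_le_le_0_compat.
    - apply Rmult_le_pos; [lra|apply sumR_nonneg; intros; apply sqrt_pos].
    - apply Rmult_le_pos; [exact Hl|apply sumR_nonneg; intros; apply coord_diam_ge0]. }
  assert (Hclose : forall r r', (r < hw)%nat -> (r' < hw)%nat ->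
                     norm2 d (vsub (gs r) (gs r')) <= 2 * S + l * Dt).
  { intros r r' Hr Hr'.
    pose proof (honest_estimates_close d hps theta gradL l (x r) (x r') (gs r) (gs r')
                  Hlip Hl (Hhull r Hr) (Hhull r' Hr')).
    pose proof (sumR_ge_term hw err r (fun _ _ => sqrt_pos _) Hr).
    pose proof (sumR_ge_term hw err r' (fun _ _ => sqrt_pos _) Hr').
    unfold S, Dt, err in *. lra. }
  eapply Rle_trans; [apply (scatter_step_Delta d hps hw eta theta Gs gs _ Heta HB Hclose)|].
  - intros j Hj. destruct (Hlst j Hj) as [K [HK [HlK Hhon]]].
    apply (mda_near_honest d fw qw (lsts j) (Gs j) K); auto; lia.
  - apply Req_le. unfold Dt, S, err. ring.
Qed.

Theorem mainTheorem9
  (d : nat) (L : vec -> R) (gradL : vec -> vec) (l eta sigma' : R)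
  (hps hw fw qw : nat) (theta : nat -> vec) (x : nat -> vec)
  (Omega : Type) (P : Expectation Omega)
  (g : nat -> Omega -> vec) (lst : nat -> Omega -> nat -> vec)
  (G : nat -> Omega -> vec) :
  is_gradient d L gradL ->
  lipschitz_grad d gradL l ->
  0 < eta ->
  (forall r i, (r < hw)%nat -> (i < d)%nat ->
     exists k1 k2, (k1 < hps)%nat /\ (k2 < hps)%nat /\
       theta k1 i <= x r i <= theta k2 i) ->
  (forall r, (r < hw)%nat ->
     Integ P (fun w => norm2 d (vsub (g r w) (gradL (x r)))) /\
     Expect P (fun w => norm2 d (vsub (g r w) (gradL (x r)))) <= sigma') ->
  (1 <= fw)%nat ->
  (2 * fw + 1 <= qw)%nat ->
  (forall j w, (j < hps)%nat ->
     exists K, NoDup K /\ (qw - fw <= length K)%nat /\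
       forall k, In k K -> (k < qw)%nat /\
         exists r, (r < hw)%nat /\ forall i, (i < d)%nat -> lst j w k i = g r w i) ->
  (forall j w, (j < hps)%nat -> is_MDA d fw qw (lst j w) (G j w)) ->
  Integ P (fun w => coord_Delta d hps (fun j => vsub (theta j) (vscal eta (G j w)))) ->
  Expect P (fun w => coord_Delta d hps (fun j => vsub (theta j) (vscal eta (G j w))))
    <= 6 * INR d * eta * INR hw * sigma' + (1 + 3 * INR d * eta * l) * coord_Delta d hps theta.
Proof.
  intros _ Hlip Heta Hx Hg _ Hq Hlst Hmda Hint.
  set (S := fun w => sumR hw (fun r => norm2 d (vsub (g r w) (gradL (x r))))).
  assert (Hsample : forall w,
    coord_Delta d hps (fun j => vsub (theta j) (vscal eta (G j w)))
    <= 6 * INR d * eta * S w + (1 + 3 * INR d * eta * l) * coord_Delta d hps theta).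
  { intros w. apply (scatter_step_sample_bound d gradL l eta hps hw fw qw
                       theta x (fun r => g r w) (fun j => G j w) (fun j => lst j w));
      auto; [lra|intros r Hr i Hi; exact (Hx r i Hr Hi)|lia]. }
  destruct (expect_sum_le Omega P hw (fun r w => norm2 d (vsub (g r w) (gradL (x r))))
              sigma' Hg) as [HIS HES].
  replace (6 * INR d * eta * INR hw * sigma') with (6 * INR d * eta * (INR hw * sigma'))
    by ring.
  apply (expect_affine_bound Omega P S); auto.
  pose proof (pos_INR d). apply Rmult_le_pos; [lra|now apply Rlt_le].
Qed.
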